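(* Let $A$ be a complete discrete valuation ring in which $2$ is a unit, with maximal ideal $\mathfrak r$ and an involution $*$. Let $B$ be the fixed field of the involution induced by $*$ on $A/\mathfrak r$, and suppose that the norm map $\mathcal N:A/\mathfrak r\to B$, $a+\mathfrak r\mapsto aa^*+\mathfrak r$, is surjective. Let $\varepsilon\in\{1,-1\}$ and $m>0$. Then two $\varepsilon$-hermitian matrices $M,N\in M_m(A)$ are $*$-congruent if and only if they have the same invariant factors.
   Context: An involution of $A$ is a ring automorphism $a\mapsto a^*$ of order at most two (the identity is allowed). Complete means that $\bigcap_{i\ge1}\mathfrak r^i=0$ and $A$ is complete for its $\mathfrak r$-adic metric. A matrix $C\in M_m(A)$ is $\varepsilon$-hermitian if $C'^*=\varepsilon C$, where $C'$ is the transpose and $*$ is applied entrywise. Matrices $C,D\in M_m(A)$ are $*$-congruent if $D=X'^*CX$ for some $X\in GL_m(A)$. Invariant factors are those of the Smith normal form over the principal ideal domain $A$ (taken up to units); $M,N$ have the same invariant factors if and only if $PMQ=N$ for some $P,Q\in GL_m(A)$. *)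

(* Defs.v *)
From HB Require Import structures.
From mathcomp Require Import all_boot all_order all_algebra.
From mathcomp Require Import generic_quotient ring_quotient.

Set Implicit Arguments.
Unset Strict Implicit.
Unset Printing Implicit Defensive.

Import GRing.Theory.
Local Open Scope ring_scope.
Local Open Scope quotient_scope.

(* Ideals as Prop-valued predicates: unlike [idealr], neither decidability nor
   properness is built in. *)
Definition is_ideal (A : comNzRingType) (I : A -> Prop) : Prop :=
  [/\ I 0, forall x y, I x -> I y -> I (x + y) & forall a x, I x -> I (a * x)].

Definition principal (A : comNzRingType) (I : A -> Prop) : Prop :=
  exists g, forall x, I x <-> exists a, x = a * g.

(* A discrete valuation ring is a local principal ideal domain which is not a
   field; a ring is local when its nonunits are stable under addition. *)
HB.mixin Record isDVR A of GRing.IntegralDomain A := {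
  ideal_principal : forall I : A -> Prop, is_ideal I -> principal I;
  nonunitD : forall x y : A,
    x \isn't a GRing.unit -> y \isn't a GRing.unit ->
    x + y \isn't a GRing.unit;
  dvr_not_field : exists x : A, (x != 0) && (x \isn't a GRing.unit)
}.

#[short(type="dvrType")]
HB.structure Definition DVR := {A of isDVR A & GRing.IntegralDomain A}.

Definition maxideal (A : dvrType) (x : A) : bool := x \isn't a GRing.unit.

Lemma maxideal_closed (A : dvrType) : idealr_closed (@maxideal A).
Proof.
split=> [||a x y]; rewrite -?topredE /= /maxideal ?unitr0 ?unitr1 //.
move=> nux nuy; apply: nonunitD => //.
by rewrite unitrM negb_and nux orbT.
Qed.

HB.instance Definition _ (A : dvrType) :=
  isIdealr.Build A (@maxideal A) (maxideal_closed A).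

Lemma maxideal_max (A : dvrType) (I : A -> Prop) :
  is_ideal I -> ~ I 1 -> forall x, I x -> x \in @maxideal A.
Proof.
move=> [_ _ IM] I1 x Ix; apply/negP => ux; apply: I1.
by rewrite -(mulVr ux); apply: IM.
Qed.

Definition residue (A : dvrType) : Type :=
  {ideal_quot (@maxideal A : idealr A)}.

HB.instance Definition _ (A : dvrType) := GRing.ComNzRing.on (residue A).
HB.instance Definition _ (A : dvrType) := EqQuotient.on (residue A).

Lemma residue_eq (A : dvrType) (x y : A) :
  (\pi_(residue A) x == \pi_(residue A) y) = (x - y \in @maxideal A).
Proof. by rewrite /residue -Quotient.idealrBE. Qed.

Definition residue_inv (A : dvrType) (x : residue A) : residue A :=
  \pi_(residue A) (repr x)^-1.

Lemma residue_mulVx (A : dvrType) (x : residue A) :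
  x != 0 -> residue_inv x * x = 1.
Proof.
rewrite -{1}[x]reprK -(rmorph0 (\pi_(residue A))) residue_eq subr0.
rewrite -topredE /= /maxideal negbK => ux.
by rewrite -{2}[x]reprK -rmorphM mulVr // rmorph1.
Qed.

Lemma residue_inv0 (A : dvrType) : residue_inv (0 : residue A) = 0.
Proof.
have r0 : repr (0 : residue A) \in @maxideal A.
  by rewrite -[repr _]subr0 -residue_eq reprK rmorph0.
by rewrite /residue_inv invr_out ?reprK.
Qed.

HB.instance Definition _ (A : dvrType) :=
  GRing.ComNzRing_isField.Build (residue A)
    (@residue_mulVx A) (@residue_inv0 A).

Definition residue_star (A : dvrType) (star : A -> A) :
  residue A -> residue A := lift_op1 (residue A) star.

Lemma pi_residue_star (A : dvrType) (star : {rmorphism A -> A}) :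
  involutive star ->
  {morph \pi_(residue A) : x / star x >-> residue_star star x}.
Proof.
move=> starK x; rewrite /residue_star; unlock; apply/eqP.
rewrite residue_eq -rmorphB -topredE /= /maxideal.
apply/negP => /(rmorph_unit star); rewrite starK; apply/negP.
by have := residue_eq x (repr (\pi_(residue A) x)); rewrite reprK eqxx.
Qed.

Definition fixed_field (A : dvrType) (star : A -> A) : {pred residue A} :=
  [pred b | residue_star star b == b].

Definition residue_norm (A : dvrType) (star : A -> A) (x : residue A) :
  residue A := x * residue_star star x.

Lemma pi_residue_norm (A : dvrType) (star : {rmorphism A -> A}) (x : A) :
  involutive star ->
  residue_norm star (\pi_(residue A) x) = \pi_(residue A) (x * star x).
Proof. by move=> starK; rewrite /residue_norm -pi_residue_star // rmorphM. Qed.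

Lemma residue_norm_fixed (A : dvrType) (star : {rmorphism A -> A})
    (x : residue A) :
  involutive star -> residue_norm star x \in fixed_field star.
Proof.
move=> starK; rewrite -[x]reprK pi_residue_norm // inE -pi_residue_star //.
by rewrite rmorphM starK mulrC.
Qed.

Definition norm_surjective (A : dvrType) (star : A -> A) : Prop :=
  forall b, b \in fixed_field star -> exists a, residue_norm star a = b.

Fixpoint ideal_pow (A : comNzRingType) (I : A -> Prop) (n : nat) : A -> Prop :=
  if n is n'.+1 then
    fun x => exists2 s : seq (A * A),
      (forall ab, ab \in s -> I ab.1 /\ ideal_pow I n' ab.2) &
      x = \sum_(ab <- s) ab.1 * ab.2
  else fun=> True.

(* Cauchy sequences and limits for the metric d given by
   d x y = 2 ^ - sup {n | x - y in I^n}. *)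
Definition adic_cauchy (A : comNzRingType) (I : A -> Prop) (u : nat -> A) :=
  forall n, exists N, forall i j, (N <= i)%N -> (N <= j)%N ->
    ideal_pow I n (u i - u j).

Definition adic_limit (A : comNzRingType) (I : A -> Prop) (u : nat -> A) l :=
  forall n, exists N, forall i, (N <= i)%N -> ideal_pow I n (u i - l).

Definition dvr_complete (A : dvrType) : Prop :=
  (forall x : A, (forall i, (1 <= i)%N -> ideal_pow (@maxideal A) i x) ->
     x = 0)
  /\ (forall u : nat -> A, adic_cauchy (@maxideal A) u ->
        exists l, adic_limit (@maxideal A) u l).

Definition eps_hermitian (A : comUnitRingType) (star : A -> A) (eps : A)
  (m : nat) (C : 'M[A]_m) : Prop := map_mx star C^T = eps *: C.

Definition star_congruent (A : comUnitRingType) (star : A -> A) (m : nat)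
    (C D : 'M[A]_m) : Prop :=
  exists2 X : 'M[A]_m, X \in unitmx & D = map_mx star X^T *m C *m X.

Definition divides (A : comUnitRingType) (a b : A) : Prop :=
  exists c, b = c * a.

Definition associated (A : comUnitRingType) (a b : A) : Prop :=
  exists2 u, u \is a GRing.unit & b = u * a.

(* d lists all m diagonal entries of a Smith normal form of C, including the
   zero ones (which come last) when C is singular. *)
Definition invariant_factors (A : comUnitRingType) (m : nat)
    (C : 'M[A]_m) (d : 'rV[A]_m) : Prop :=
  (forall i j : 'I_m, (i <= j)%N -> divides (d 0 i) (d 0 j))
  /\ (exists P Q : 'M[A]_m,
        [/\ P \in unitmx, Q \in unitmx & P *m C *m Q = diag_mx d]).

Definition same_invariant_factors (A : comUnitRingType) (m : nat)
    (C D : 'M[A]_m) : Prop :=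
  exists c d : 'rV[A]_m,
    [/\ invariant_factors C c, invariant_factors D d &
        forall i, associated (c 0 i) (d 0 i)].

(* Main.v *)
(* If N = P M Q, strip the largest power of a uniformizer z with z^* = z or -z
   from both matrices, so that M and N become hermitian or skew-hermitian and
   have a unit entry. In the hermitian case, some unit is represented on the
   diagonal because 2 is a unit, and it is a norm because the residue norm is
   surjective and 1 + r has square roots fixed by *; so both split off a block
   1. In the skew case, a unit diagonal entry s is skew, and multiplication by s
   leads back to the hermitian case; without unit diagonal entries both split
   off the standard hyperbolic plane. The same block is split off from M and N,
   and the complements are again equivalent since blocks 1 cancel from
   equivalences over a local ring; induct on the size. *)
Require Import Defs.
From mathcomp Require Import all_boot all_order all_algebra.
From mathcomp Require Import fingroup perm ring_quotient generic_quotient ring.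
Import GRing.Theory.
Local Open Scope ring_scope.

(** * Discrete valuation rings with involution *)

Section Local.

Local Open Scope quotient_scope.
Set Implicit Arguments.
Unset Strict Implicit.

Variable A : dvrType.
Implicit Types a h u w x y z : A.

Lemma mem_maxideal x : (x \in @maxideal A) = (x \isn't a GRing.unit).
Proof. by []. Qed.

Lemma unitrD_nonunit x z :
  x \is a GRing.unit -> z \isn't a GRing.unit -> x + z \is a GRing.unit.
Proof.
move=> ux nz; apply/negPn/negP => nxz; move: ux.
by apply/negP; rewrite -(addrK z x) nonunitD ?unitrN.
Qed.

Lemma nonunit_sum (I : finType) (F : I -> A) :
  (forall i, F i \isn't a GRing.unit) -> \sum_i F i \isn't a GRing.unit.
Proof.
by move=> nF; rewrite -mem_maxideal; apply: rpred_sum => i _; exact: nF.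
Qed.

Lemma nonunitMl x z : z \isn't a GRing.unit -> x * z \isn't a GRing.unit.
Proof. by move=> nz; rewrite unitrM negb_and nz orbT. Qed.

Lemma nonunitMr x z : z \isn't a GRing.unit -> z * x \isn't a GRing.unit.
Proof. by rewrite mulrC; exact: nonunitMl. Qed.

(** * Uniformizers and powers of the maximal ideal *)

Definition uniformizer y :=
  y != 0 /\ forall x, x \isn't a GRing.unit <-> exists a, x = a * y.

Lemma uniformizer_nonunit y : uniformizer y -> y \isn't a GRing.unit.
Proof. by case=> _ yP; apply/yP; exists 1; rewrite mul1r. Qed.

Lemma uniformizer_unitM y u :
  uniformizer y -> u \is a GRing.unit -> uniformizer (y * u).
Proof.
move=> [y0 yP] uu; split=> [|x].
  by rewrite mulf_neq0 //; apply: contraTneq uu => ->; rewrite unitr0.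
split=> [/yP [a ->]|[a ->]].
  by exists (a * u^-1); rewrite mulrCA mulrC -!mulrA mulVr // mulr1 mulrC.
by apply/yP; exists (a * u); rewrite mulrA mulrAC.
Qed.

Lemma uniformizer_exists : exists y, uniformizer y.
Proof.
have [|y yP] := @ideal_principal A (fun x => x \isn't a GRing.unit).
  split; [by rewrite unitr0|exact: nonunitD|by move=> a x; exact: nonunitMl].
exists y; split=> //; apply/eqP=> y0.
have [x /andP [x0 /yP [a xE]]] := @dvr_not_field A.
by move: x0; rewrite xE y0 mulr0 eqxx.
Qed.

Variables (y : A) (y_unif : uniformizer y).

(* The ideal of all z with some multiple z * y ^+ k in (x) is stable under
   division by y, so its generator is a unit. *)
Lemma unif_factor x :
  x != 0 -> exists k u, u \is a GRing.unit /\ x = u * y ^+ k.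
Proof.
have [y0 yP] := y_unif => x0.
have [|g gP] := @ideal_principal A
    (fun z => exists k c, z * y ^+ k = c * x).
  split=> [|z z' [k [c zE]] [k' [c' z'E]]|a z [k [c zE]]].
  - by exists 0%N, 0; rewrite !mul0r.
  - exists (k + k')%N, (c * y ^+ k' + c' * y ^+ k).
    have -> : (z + z') * y ^+ (k + k') =
        z * y ^+ k * y ^+ k' + z' * y ^+ k' * y ^+ k.
      by rewrite exprD; ring.
    by rewrite zE z'E; ring.
  - by exists k, (a * c); rewrite -!mulrA zE.
have ug : g \is a GRing.unit.
  apply/negPn/negP => /yP [g' gE].
  have [k [c gk]] := (gP g).2 (ex_intro _ 1 (esym (mul1r g))).
  have /gP [b g'E] : exists k c, g' * y ^+ k = c * x.
    by exists k.+1, c; rewrite exprS mulrA -gE.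
  have /eqP : g' * (1 - b * y) = 0.
    by rewrite mulrBr mulr1 {1}g'E gE; ring.
  have ub : 1 - b * y \is a GRing.unit.
    by rewrite unitrD_nonunit ?unitr1 // unitrN; apply/yP; exists b.
  rewrite mulf_eq0 [X in _ || X]negbTE ?orbF; last first.
    by apply: contraTneq ub => ->; rewrite unitr0.
  move=> /eqP g'0.
  have /gP [a xE] : exists k c, x * y ^+ k = c * x.
    by exists 0%N, 1; rewrite mulrC.
  by move: x0; rewrite xE gE g'0 mul0r mulr0 eqxx.
have /gP [k [c]] : exists a, 1 = a * g by exists g^-1; rewrite mulVr.
rewrite mul1r; elim: k c => [|k IH] c cE.
  have ux : x \is a GRing.unit by apply/unitrPr; exists c; rewrite mulrC -cE.
  by exists 0%N, x; rewrite mulr1.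
have [uc|/yP [c' c'E]] := boolP (c \is a GRing.unit).
  by exists k.+1, c^-1; rewrite unitrV cE mulKr.
apply: (IH c'); apply: (mulIf y0).
by rewrite -exprSr cE c'E mulrAC.
Qed.

(** Turns the powers of the maximal ideal, encoded by finite sums of products, into divisibility by
    [y ^+ n], the form in which convergence is checked below. *)
Lemma ideal_pow_unif n x :
  ideal_pow (@maxideal A) n x <-> exists a, x = a * y ^+ n.
Proof.
have [y0 yP] := y_unif.
elim: n x => [|n IH] x /=; first by split=> // _; exists x; rewrite mulr1.
split=> [[s sP ->]|[a ->]].
  elim: s sP => [|[a b] s IHs] sP; first by exists 0; rewrite big_nil mul0r.
  have [/= /yP [a' aE] /IH [b' bE]] := sP _ (mem_head _ _).
  have [|c cE] := IHs; first by move=> ab abs; apply: sP; rewrite inE abs orbT.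
  exists (a' * b' + c); rewrite big_cons cE /= aE bE exprS; ring.
exists [:: (y, a * y ^+ n)].
  move=> ab; rewrite inE => /eqP -> /=; split.
    exact: uniformizer_nonunit.
  by apply/IH; exists a.
by rewrite big_seq1 /= exprS mulrCA.
Qed.

(** * Square roots near 1 *)

Hypothesis A_complete : dvr_complete A.
Hypothesis unit2 : (2%:R : A) \is a GRing.unit.

(* Newton's iteration for t ^ 2 = 1 + h with the slope 2t replaced by its
   residue 2; convergence is linear, which is enough. *)
Lemma sqrt_1Dnonunit h :
  h \isn't a GRing.unit ->
  exists w, w ^+ 2 = 1 + h /\ w - 1 \isn't a GRing.unit.
Proof.
have [y0 yP] := y_unif => nh.
pose f (t : A) := t ^+ 2 - (1 + h).
pose t := fix t n : A := if n is n'.+1 then t n' - f (t n') / 2%:R else 1.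
(* While [t n] is 1 and [f (t n)] is 0 modulo [y], the second factor is divisible by [y], so the
   error gains a factor [y] at each step. *)
have f_rec n : f (t n.+1) = f (t n) * (1 - t n + f (t n) / 4%:R).
  have -> : 4%:R = 2%:R ^+ 2 :> A by rewrite -natrX.
  rewrite /= {1}/f; set F := f (t n).
  have tn : t n ^+ 2 = F + (1 + h) by rewrite /F /f subrK.
  have h21 : 2%:R * 2%:R^-1 = 1 :> A by rewrite divrr.
  rewrite -exprVn; set v := 2%:R^-1 in h21 *.
  rewrite sqrrB tn.
  have -> : t n * (F * v) *+ 2 = t n * F * (2%:R * v) by ring.
  rewrite h21; ring.
have tP n : (exists a, t n - 1 = a * y) /\ (exists b, f (t n) = b * y ^+ n.+1).
  elim: n => [|n [[a aE] [b bE]]].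
    split; first by exists 0; rewrite subrr mul0r.
    have /yP [b bE] : - h \isn't a GRing.unit by rewrite unitrN.
    by exists b; rewrite /f expr1 -bE /=; ring.
  have tE : t n = 1 + a * y by rewrite -aE; ring.
  split; last first.
    exists (b * (b * y ^+ n / 4%:R - a)).
    by rewrite f_rec bE tE !exprS; ring.
  by exists (a - b * y ^+ n / 2%:R); rewrite /= bE tE exprS; ring.
have step n d : exists c, t (n + d)%N - t n = c * y ^+ n.
  elim: d => [|d [c cE]]; first by exists 0; rewrite addn0 subrr mul0r.
  have [_ [b bE]] := tP (n + d)%N.
  exists (c - b * y ^+ d.+1 / 2%:R).
  rewrite mulrBl -cE addnS /= bE -addnS exprD; ring.
have [|w wP] := A_complete.2 t.
  move=> n; exists n => i j /subnKC <- /subnKC <-; apply/ideal_pow_unif.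
  have [c cE] := step n (i - n)%N; have [d dE] := step n (j - n)%N.
  by exists (c - d); rewrite mulrBl -cE -dE; ring.
exists w; split.
  apply/eqP; rewrite -subr_eq0; apply/eqP; apply: A_complete.1 => n _.
  have [N NP] := wP n; apply/ideal_pow_unif.
  have [c] := (ideal_pow_unif _ _).1 (NP _ (leq_maxl N n)).
  have [_ [b]] := tP (maxn N n).
  rewrite /f; set T := t _ => bE cE.
  (* Here [f w = f T - (T - w) * (T + w)]: an index beyond [n] makes [f T] divisible by [y ^+ n],
     and one beyond [N] does so for [T - w]. *)
  exists (b * y ^+ ((maxn N n).+1 - n) - c * (T + w)).
  rewrite mulrBl -mulrA -exprD subnK ?leqW ?leq_maxr // -bE.
  by rewrite mulrAC -cE; ring.
have [N NP] := wP 1%N; have [c cE] := (ideal_pow_unif _ _).1 (NP _ (leqnn N)).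
have [[a aE] _] := tP N; apply/yP; exists (a - c).
by rewrite mulrBl -aE -[y]expr1 -cE; ring.
Qed.

(** * Fixed square roots, norms and uniformizers under the involution *)

Section Involution.

Variable star : {rmorphism A -> A}.
Hypothesis starK : involutive star.

Lemma star_unit x : (star x \is a GRing.unit) = (x \is a GRing.unit).
Proof.
by apply/idP/idP => /(rmorph_unit star) //; rewrite starK.
Qed.

(** For a nonunit both sides are [star x]: by convention the inverse of a nonunit is itself, and
    [star] preserves nonunits. *)
Lemma starV x : star x^-1 = (star x)^-1.
Proof.
have [ux|nux] := boolP (x \is a GRing.unit); first by rewrite rmorphV.
by rewrite !invr_out ?star_unit.
Qed.

(** The root congruent to 1 is unique: [star w] and [w] have the same square, and their sum is
    congruent to 2, hence a unit. *)
Lemma sqrt_fixed h :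
  h \isn't a GRing.unit -> star h = h ->
  exists w, [/\ w ^+ 2 = 1 + h, w - 1 \isn't a GRing.unit & star w = w].
Proof.
move=> nh hE; have [w [w2 nw]] := sqrt_1Dnonunit nh.
exists w; split=> //; apply/eqP; rewrite -subr_eq0; apply/eqP.
have usum : star w + w \is a GRing.unit.
  have -> : star w + w = 2%:R + (star (w - 1) + (w - 1)).
    by rewrite rmorphB rmorph1; ring.
  by rewrite unitrD_nonunit // nonunitD // star_unit.
apply: (mulIr usum); rewrite mul0r.
have -> : (star w - w) * (star w + w) = star (w ^+ 2) - w ^+ 2.
  by rewrite rmorphXn; ring.
by rewrite w2 rmorphD rmorph1 hE subrr.
Qed.

(** Lift a residue preimage of [a] under the norm to [z]. Then [z * star z / a] is [1 + h] with [h]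
    a fixed nonunit, and dividing [z] by a fixed square root of [1 + h] corrects the norm to [a]. *)
Lemma norm_fixed_unit a :
  norm_surjective star -> a \is a GRing.unit -> star a = a ->
  exists z, a = star z * z.
Proof.
move=> nsurj ua aE.
have [|r] := nsurj (\pi_(residue A) a).
  by rewrite inE -pi_residue_star // aE.
rewrite -[r]reprK pi_residue_norm //; set z := repr r => /eqP.
rewrite residue_eq mem_maxideal => nza.
have [||w [w2 nw wE]] := @sqrt_fixed ((z * star z - a) / a).
- by rewrite nonunitMr.
- rewrite rmorphM starV rmorphB rmorphM starK aE mulrC.
  by rewrite [star z * z]mulrC mulrC.
have uw : w \is a GRing.unit.
  by rewrite -(subrK 1 w) addrC unitrD_nonunit ?unitr1.
exists (z / w); rewrite rmorphM starV wE.
have -> : star z / w * (z / w) = z * star z / w ^+ 2.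
  by rewrite -exprVn; ring.
apply: (mulIr (unitrX 2 uw)); rewrite divrK ?unitrX //.
by rewrite w2 mulrDr mulr1 mulrCA divrr // mulr1 addrC subrK.
Qed.

(** The fixed part [p] and the skew part [q] of [y] are both multiples of [y], with cofactors that
    add up to 1; one cofactor is therefore a unit. *)
Lemma uniformizer_sign :
  exists z, uniformizer z /\ (star z = z \/ star z = - z).
Proof.
have [y0 yP] := y_unif; have ny := uniformizer_nonunit y_unif.
pose p := (y + star y) / 2%:R; pose q := (y - star y) / 2%:R.
have star2 : star 2%:R^-1 = 2%:R^-1 by rewrite starV rmorph_nat.
have pE : star p = p.
  by rewrite /p rmorphM star2 rmorphD starK addrC.
have qE : star q = - q.
  by rewrite /q rmorphM star2 rmorphB starK -mulNr opprB.
have /yP [p' p'E] : p \isn't a GRing.unit.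
  by rewrite nonunitMr // nonunitD // star_unit.
have /yP [q' q'E] : q \isn't a GRing.unit.
  by rewrite nonunitMr // nonunitD ?unitrN // star_unit.
have sum1 : p' + q' = 1.
  apply: (mulIf y0); rewrite mulrDl -p'E -q'E /p /q mul1r -mulrDl.
  by rewrite addrACA subrr addr0 -mulr2n -[y *+ 2]mulr_natr mulrK.
have [up|np] := boolP (p' \is a GRing.unit).
  exists p; split; last by left.
  by rewrite p'E mulrC; exact: uniformizer_unitM.
exists q; split; last by right.
rewrite q'E mulrC; apply: uniformizer_unitM => //.
by rewrite -(addKr p' q') sum1 addrC unitrD_nonunit ?unitr1 ?unitrN.
Qed.

End Involution.
End Local.
(** * Equivalence and Smith normal form *)

Section Equivalence.

Set Implicit Arguments.
Unset Strict Implicit.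

Variable A : dvrType.

Definition equivalent m (M N : 'M[A]_m) :=
  exists P Q, [/\ P \in unitmx, Q \in unitmx & P *m M *m Q = N].

Lemma equivalent_refl m (M : 'M[A]_m) : equivalent M M.
Proof. by exists 1%:M, 1%:M; rewrite unitmx1 mul1mx mulmx1. Qed.

Lemma equivalent_trans m (M N L : 'M[A]_m) :
  equivalent M N -> equivalent N L -> equivalent M L.
Proof.
move=> [P [Q [uP uQ <-]]] [P' [Q' [uP' uQ' <-]]].
by exists (P' *m P), (Q *m Q'); rewrite !unitmx_mul uP uP' uQ uQ' !mulmxA.
Qed.

Lemma equivalent_sym m (M N : 'M[A]_m) : equivalent M N -> equivalent N M.
Proof.
move=> [P [Q [uP uQ <-]]]; exists (invmx P), (invmx Q).
by rewrite !unitmx_inv uP uQ !mulmxA mulVmx // mul1mx mulmxK.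
Qed.

Lemma equivalent_scale m a (M N : 'M[A]_m) :
  equivalent M N -> equivalent (a *: M) (a *: N).
Proof.
move=> [P [Q [uP uQ <-]]]; exists P, Q.
by rewrite uP uQ -scalemxAr -scalemxAl.
Qed.

(** * Block matrices, Schur complements and cancellation *)

Lemma unitmx_ublock n1 n2 (a : 'M[A]_n1) (b : 'M_(n1, n2)) (d : 'M_n2) :
  (block_mx a b 0 d \in unitmx) = (a \in unitmx) && (d \in unitmx).
Proof. by rewrite !unitmxE det_ublock unitrM. Qed.

Lemma unitmx_lblock n1 n2 (a : 'M[A]_n1) (c : 'M_(n2, n1)) (d : 'M_n2) :
  (block_mx a 0 c d \in unitmx) = (a \in unitmx) && (d \in unitmx).
Proof. by rewrite !unitmxE det_lblock unitrM. Qed.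

Lemma equivalent_block n1 n2 (H H' : 'M[A]_n1) (M M' : 'M_n2) :
  equivalent H H' -> equivalent M M' ->
  equivalent (block_mx H 0 0 M) (block_mx H' 0 0 M').
Proof.
move=> [P [Q [uP uQ <-]]] [P' [Q' [uP' uQ' <-]]].
exists (block_mx P 0 0 P'), (block_mx Q 0 0 Q').
rewrite !unitmx_ublock uP uP' uQ uQ'; split=> //.
by rewrite !mulmx_block !(mulmx0, mul0mx, addr0, add0r).
Qed.

Lemma unitmx_schur n1 n2 (a : 'M[A]_n1) (b : 'M_(n1, n2)) c (d : 'M_n2) :
  a \in unitmx -> block_mx a b c d \in unitmx ->
  d - c *m invmx a *m b \in unitmx.
Proof.
move=> ua u.
have : block_mx a b c d *m block_mx 1%:M (- (invmx a *m b)) 0 1%:M \in unitmx.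
  by rewrite unitmx_mul u unitmx_ublock !unitmx1.
rewrite mulmx_block !(mulmx1, mulmx0, addr0) !mulmxN mulmxA mulmxV // mul1mx.
rewrite addNr mulmxA unitmx_lblock => /andP [_].
by rewrite addrC.
Qed.

(** A row of nonunits would make a diagonal entry of [P *m invmx P] a nonunit. *)
Lemma unitmx_row_unit n (P : 'M[A]_n) i :
  P \in unitmx -> exists j, P i j \is a GRing.unit.
Proof.
move=> uP; apply/existsP; apply: contraT => /existsPn nP.
have : (P *m invmx P) i i \isn't a GRing.unit.
  by rewrite mxE; apply: nonunit_sum => j; rewrite nonunitMr.
by rewrite mulmxV // mxE eqxx unitr1.
Qed.

Lemma unitmx11 (a : 'M[A]_1) : (a \in unitmx) = (a 0 0 \is a GRing.unit).
Proof. by rewrite unitmxE det_mx11. Qed.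

(* Cancellation: given P (1 + M) = (1 + N) Q, either the corner of P is a unit
   and Schur complements give an equivalence of M and N, or an automorphism of
   1 + M first makes it one, the first row of Q being unimodular. *)
Lemma equivalent_cancel n (M N : 'M[A]_n) :
  equivalent (block_mx (1%:M : 'M_1) 0 0 M) (block_mx 1%:M 0 0 N) ->
  equivalent M N.
Proof.
have schur (P Q : 'M[A]_(1 + n)) : P \in unitmx -> Q \in unitmx ->
    P *m block_mx 1%:M 0 0 M = block_mx 1%:M 0 0 N *m Q ->
    ulsubmx P \in unitmx -> equivalent M N.
  rewrite -{1 2}[P]submxK -{1 2}[Q]submxK.
  set a := ulsubmx P; set b := ursubmx P.
  set c := dlsubmx P; set d := drsubmx P.
  set a' := ulsubmx Q; set b' := ursubmx Q.
  set c' := dlsubmx Q; set d' := drsubmx Q.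
  move=> uP uQ; rewrite !mulmx_block.
  rewrite !(mulmx0, mul0mx, mulmx1, mul1mx, addr0, add0r).
  move=> /eq_block_mx [aE bE cE dE] ua.
  have uS := unitmx_schur ua uP.
  have uS' : d' - c' *m invmx a' *m b' \in unitmx.
    by apply: unitmx_schur => //; rewrite -aE.
  (* The block equations [a = a'], [b M = b'], [c = N c'] and [d M = N d'] give [S M = N S'] for the
     Schur complements [S] of [P] and [S'] of [Q]. *)
  apply: (@equivalent_trans _ _ (N *m (d' - c' *m invmx a' *m b'))); last first.
    by apply: equivalent_sym; exists 1%:M, (d' - c' *m invmx a' *m b');
      rewrite unitmx1 mul1mx.
  exists (d - c *m invmx a *m b), 1%:M; rewrite unitmx1 mulmx1; split=> //.
  by rewrite mulmxBl mulmxBr dE cE -aE -bE !mulmxA.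
move=> [P [Q [uP uQ PQ]]].
have {uQ PQ} [uR PR] : invmx Q \in unitmx /\
    P *m block_mx 1%:M 0 0 M = block_mx 1%:M 0 0 N *m invmx Q.
  by rewrite unitmx_inv uQ -PQ mulmxK.
move: (invmx Q) uR PR => {Q} Q uQ PQ.
have [ua|na] := boolP (ulsubmx P \in unitmx); first exact: (schur P Q).
have aE : ulsubmx P = ulsubmx Q.
  move: PQ; rewrite -{1}[P]submxK -{1}[Q]submxK !mulmx_block.
  by rewrite !(mulmx0, mul0mx, mulmx1, mul1mx, addr0, add0r) => /eq_block_mx [].
have bE : ursubmx P *m M = ursubmx Q.
  move: PQ; rewrite -{1}[P]submxK -{1}[Q]submxK !mulmx_block.
  by rewrite !(mulmx0, mul0mx, mulmx1, mul1mx, addr0, add0r) => /eq_block_mx [].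
have [j uj] := unitmx_row_unit (lshift n 0) uQ.
have [k uk] : exists k, ursubmx Q 0 k \is a GRing.unit.
  case: (split_ordP j) uj => k -> uk.
    by case/negP: na; rewrite aE unitmx11 !mxE -{2}(ord1 k).
  by exists k; rewrite !mxE.
(* The unitriangular matrices with lower left blocks [M *m w] and [w] are intertwined by the block
   matrix of 1 and [M], so the relation persists. The corner of [P] becomes its old nonunit value
   plus entry [k] of [ursubmx Q], a unit. *)
pose w : 'cV[A]_n := delta_mx k 0.
apply: (schur (P *m block_mx 1%:M 0 (M *m w) 1%:M)
              (Q *m block_mx 1%:M 0 w 1%:M)).
- by rewrite unitmx_mul uP unitmx_lblock !unitmx1.
- by rewrite unitmx_mul uQ unitmx_lblock !unitmx1.
- rewrite -mulmxA [RHS]mulmxA -PQ -mulmxA; congr (_ *m _).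
  by rewrite !mulmx_block !(mulmx0, mul0mx, mulmx1, mul1mx, addr0, add0r).
- rewrite -{1}[P]submxK mulmx_block block_mxKul mulmx1 mulmxA bE unitmx11.
  rewrite mxE addrC unitrD_nonunit -?unitmx11 // unitmx11.
  by rewrite -colE mxE.
Qed.

(** Lets an identity block of size 2 be cancelled in two steps of size 1. *)
Lemma block_mx11A n (L : 'M[A]_n) :
  block_mx (1%:M : 'M_2) 0 0 L =
  block_mx (1%:M : 'M_1) 0 0 (block_mx (1%:M : 'M_1) 0 0 L).
Proof.
have := @block_mxA A 1 1 n 1 1 n 1%:M 0 0 0 1%:M 0 0 0 L.
by rewrite /= castmx_id !row_mx0 !col_mx0 -scalar_mx_block.
Qed.

(** * Unit entries and Smith normal form *)

Definition has_unit m n (M : 'M[A]_(m, n)) :=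
  [exists i, exists j, M i j \is a GRing.unit].

Lemma has_unitP m n (M : 'M[A]_(m, n)) :
  reflect (exists i j, M i j \is a GRing.unit) (has_unit M).
Proof.
apply: (iffP existsP) => [[i /existsP [j uj]]|[i [j uj]]]; first by exists i, j.
by exists i; apply/existsP; exists j.
Qed.

Lemma has_unitPn m n (M : 'M[A]_(m, n)) :
  ~~ has_unit M -> forall i j, M i j \isn't a GRing.unit.
Proof.
by move=> nM i j; apply: contra nM => uij; apply/has_unitP; exists i, j.
Qed.

Lemma equivalent_has_unit m (M N : 'M[A]_m) :
  equivalent M N -> has_unit M -> has_unit N.
Proof.
move=> /equivalent_sym [P [Q [_ _ <-]]]; apply: contraTT => nN.
apply/has_unitP => -[i [j]]; apply/negP.
rewrite mxE; apply: nonunit_sum => k; rewrite nonunitMr // mxE.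
by apply: nonunit_sum => l; rewrite nonunitMl // has_unitPn.
Qed.

(** Permutations bring the unit into the corner; block elimination then clears its row and
    column. *)
Lemma has_unit_equivalent n (M : 'M[A]_(1 + n)) :
  has_unit M -> exists M1 : 'M_n, equivalent M (block_mx 1%:M 0 0 M1).
Proof.
move=> /has_unitP [i [j uij]].
pose N : 'M[A]_(1 + n) := row_perm (tperm 0 i) (col_perm (tperm 0 j) M).
have MN : equivalent M N.
  exists (perm_mx (tperm 0 i)), (perm_mx (tperm 0 j)^-1).
  by rewrite !unitmx_perm /N row_permE col_permE mulmxA.
have ua : ulsubmx N \in unitmx.
  by rewrite unitmx11 !mxE lshift0 !tpermL.
pose a := ulsubmx N; pose b := ursubmx N; pose c := dlsubmx N.
have NE : N = block_mx a b c (drsubmx N) by rewrite submxK.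
exists (drsubmx N - c *m invmx a *m b); apply: equivalent_trans MN _.
exists (block_mx (invmx a) 0 (- (c *m invmx a)) 1%:M).
exists (block_mx 1%:M (- (invmx a *m b)) 0 1%:M).
rewrite unitmx_lblock unitmx_ublock unitmx_inv ua !unitmx1; split=> //.
rewrite {1}NE !mulmx_block !(mulmx0, mul0mx, mulmx1, mul1mx, addr0, add0r).
rewrite mulVmx // mul1mx addNr !mulNmx -(mulmxA _ (invmx a)) mulVmx // mulmx1.
by rewrite addNr mul0mx add0r addrC.
Qed.

Variables (y : A) (y_unif : uniformizer y).

(** Divide by [y] as long as no entry is a unit; the valuation of one chosen nonzero entry drops
    each time, so this stops. *)
Lemma unif_scale m n (M : 'M[A]_(m, n)) :
  M != 0 -> exists k M', has_unit M' /\ M = y ^+ k *: M'.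
Proof.
move=> M0; have [i [j Mij]] : exists i j, M i j != 0.
  have [/existsP [i /existsP [j Mij]]|/existsPn nM] :=
    boolP [exists i, exists j, M i j != 0]; first by exists i, j.
  case/eqP: M0; apply/matrixP => i j; rewrite mxE; apply/eqP.
  by have /existsPn/(_ j) := nM i; rewrite negbK.
have [k [u [uu]]] := unif_factor y_unif Mij.
elim: k M {M0 Mij} => [|k IH] M ME.
  exists 0%N, M; rewrite scale1r; split=> //; apply/has_unitP.
  by exists i, j; rewrite ME mulr1.
have [uM|nM] := boolP (has_unit M); first by exists 0%N, M; rewrite scale1r.
have divM i' : exists f, forall j', M i' j' = f j' * y.
  apply: (@fin_all_exists _ _ (fun j' a => M i' j' = a * y)) => j'.
  by apply: (y_unif.2 _).1; exact: has_unitPn.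
have [f fE] := fin_all_exists divM.
have ME' : M = y *: \matrix_(i', j') f i' j'.
  by apply/matrixP => i' j'; rewrite !mxE fE mulrC.
have [|l [M' [uM' M'E]]] := IH (\matrix_(i', j') f i' j').
  by apply: (mulIf y_unif.1); rewrite mxE -fE ME exprSr mulrA.
by exists l.+1, M'; rewrite ME' M'E scalerA exprS.
Qed.

(** Strip the power [y ^+ k], split off a 1 and recurse. The first entry [y ^+ k] divides the
    others, which all carry this factor. *)
Lemma smith_exists m (M : 'M[A]_m) : exists d, invariant_factors M d.
Proof.
elim: m M => [|n IH] M.
  exists 0; split=> [[]//|]; exists 1%:M, 1%:M; rewrite unitmx1; split=> //.
  by apply/matrixP => -[].
have [->|M0] := eqVneq M 0.
  exists 0; split=> [i j _|]; first by exists 0; rewrite !mxE mul0r.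
  exists 1%:M, 1%:M; rewrite unitmx1 mul1mx mulmx1; split=> //.
  by apply/matrixP => i j; rewrite !mxE mul0rn.
have [k [M' [uM' ->]]] := unif_scale M0.
have [M1 M'M1] := has_unit_equivalent uM'.
have [d [dP M1d]] := IH M1.
pose e : 'rV[A]_(1 + n) := y ^+ k *: row_mx (const_mx 1) d.
have el i : e 0 (lshift n i) = y ^+ k by rewrite mxE row_mxEl mxE mulr1.
have er j : e 0 (rshift 1 j) = y ^+ k * d 0 j by rewrite mxE row_mxEr.
exists e; split.
  move=> i j.
  case: (@split_ordP 1 n i) => i' ->; case: (@split_ordP 1 n j) => j' ->.
  - by rewrite !ord1; exists 1; rewrite mul1r.
  - by exists (d 0 j'); rewrite er el mulrC.
  - by rewrite ord1.
  - rewrite /= leq_add2l => /dP [c cE]; exists c.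
    by rewrite !er cE; ring.
have : equivalent (y ^+ k *: M')
    (y ^+ k *: block_mx (1%:M : 'M_1) 0 0 (diag_mx d)).
  apply: equivalent_scale; apply: equivalent_trans M'M1 _.
  by apply: equivalent_block; [exact: equivalent_refl|exact: M1d].
suff -> : diag_mx e = y ^+ k *: block_mx 1%:M 0 0 (diag_mx d) by [].
by rewrite -diag_const_mx -diag_mx_row -linearZ.
Qed.

(** Forward, a Smith form of [M] also serves [N]. Backward, associated diagonals differ by a
    diagonal matrix of units. *)
Lemma equivalent_same_invariant_factors m (M N : 'M[A]_m) :
  equivalent M N <-> same_invariant_factors M N.
Proof.
split=> [MN|[c [d [[_ Mc] [_ Nd] cd]]]].
  have [d [dP Md]] := smith_exists M; exists d, d; split.
  - by split.
  - by split=> //; apply: equivalent_trans (equivalent_sym MN) Md.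
  - by move=> i; exists 1; rewrite ?unitr1 ?mul1r.
apply: equivalent_trans Mc _; apply: equivalent_trans (equivalent_sym Nd).
have [u uu uE] : exists2 u : 'I_m -> A,
    forall i, u i \is a GRing.unit & forall i, d 0 i = u i * c 0 i.
  apply: (@fin_all_exists2 _ _ (fun i u => u \is a GRing.unit)
    (fun i u => d 0 i = u * c 0 i)) => i.
  by case: (cd i) => u; exists u.
exists (diag_mx (\row_i u i)), 1%:M; rewrite unitmx1 mulmx1; split=> //.
  rewrite unitmxE det_diag; apply: rpred_prod => i _.
  by rewrite mxE.
by rewrite mul_diag_mx; apply/matrixP => i j; rewrite !mxE uE mulrnAr.
Qed.

End Equivalence.
(** * Congruence of hermitian matrices *)

Section Congruence.

Set Implicit Arguments.
Unset Strict Implicit.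

Variables (A : dvrType) (star : {rmorphism A -> A}).
Hypothesis starK : involutive star.

Local Notation adj M := (map_mx star M^T).
Local Notation cg := (star_congruent star).

Lemma adjM m n p (M : 'M[A]_(m, n)) (N : 'M_(n, p)) :
  adj (M *m N) = adj N *m adj M.
Proof. by rewrite trmx_mul map_mxM. Qed.

Lemma adjK m n (M : 'M[A]_(m, n)) : adj (adj M) = M.
Proof. by apply/matrixP => i j; rewrite !mxE starK. Qed.

Lemma adj_unit n (M : 'M[A]_n) : (adj M \in unitmx) = (M \in unitmx).
Proof.
have sub (N : 'M[A]_n) : N \in unitmx -> adj N \in unitmx.
  by move=> uN; rewrite unitmxE det_map_mx det_tr rmorph_unit -?unitmxE.
by apply/idP/idP => /sub //; rewrite adjK.
Qed.

Lemma adj_block m1 m2 n1 n2 (a : 'M[A]_(m1, n1)) (b : 'M_(m1, n2)) c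
    (d : 'M_(m2, n2)) :
  adj (block_mx a b c d) = block_mx (adj a) (adj c) (adj b) (adj d).
Proof. by rewrite tr_block_mx map_block_mx. Qed.

Lemma adj0 m n : adj (0 : 'M[A]_(m, n)) = 0.
Proof. by rewrite trmx0 map_mx0. Qed.

Lemma adj1 n : adj (1%:M : 'M[A]_n) = 1%:M.
Proof. by rewrite trmx1 map_mx1. Qed.

Lemma cg_refl n (M : 'M[A]_n) : cg M M.
Proof. by exists 1%:M; rewrite ?unitmx1 // adj1 mul1mx mulmx1. Qed.

Lemma cg_trans n (M N L : 'M[A]_n) : cg M N -> cg N L -> cg M L.
Proof.
move=> [X uX ->] [Y uY ->]; exists (X *m Y); first by rewrite unitmx_mul uX.
by rewrite adjM !mulmxA.
Qed.

Lemma cg_sym n (M N : 'M[A]_n) : cg M N -> cg N M.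
Proof.
move=> [X uX ->]; exists (invmx X); first by rewrite unitmx_inv.
rewrite !mulmxA -adjM mulmxV // adj1 mul1mx -mulmxA mulmxV // mulmx1 //.
Qed.

Lemma cg_scale n a (M N : 'M[A]_n) : cg M N -> cg (a *: M) (a *: N).
Proof.
by move=> [X uX ->]; exists X => //; rewrite -scalemxAr -scalemxAl.
Qed.

Lemma cg_equivalent n (M N : 'M[A]_n) : cg M N -> equivalent M N.
Proof. by move=> [X uX ->]; exists (adj X), X; rewrite adj_unit uX. Qed.

Lemma cg_block n1 n2 (H H' : 'M[A]_n1) (M M' : 'M_n2) :
  cg H H' -> cg M M' -> cg (block_mx H 0 0 M) (block_mx H' 0 0 M').
Proof.
move=> [X uX ->] [Y uY ->]; exists (block_mx X 0 0 Y).
  by rewrite unitmx_ublock uX.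
by rewrite adj_block !adj0 !mulmx_block !(mulmx0, mul0mx, addr0, add0r).
Qed.

Lemma cg_perm n (s : 'S_n) (M : 'M[A]_n) :
  cg M (\matrix_(i, j) M (s i) (s j)).
Proof.
exists (perm_mx s^-1); first exact: unitmx_perm.
rewrite tr_perm_mx map_perm_mx invgK -row_permE -col_permE.
by apply/matrixP => i j; rewrite !mxE.
Qed.

(** * Orthogonal splitting of hermitian and skew matrices *)

Section Hermitian.

Variables (eps : A) (eps_sign : eps = 1 \/ eps = -1).

Lemma sign_sqr : eps * eps = 1.
Proof. by case: eps_sign => ->; rewrite ?mulrNN mulr1. Qed.

Lemma adjZ m n a (M : 'M[A]_(m, n)) : adj (a *: M) = star a *: adj M.
Proof. by rewrite linearZ /= map_mxZ. Qed.

Lemma hermitian_entry n (M : 'M[A]_n) i j :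
  eps_hermitian star eps M -> star (M i j) = eps * M j i.
Proof. by move/matrixP/(_ j i); rewrite !mxE. Qed.

Lemma hermitian_cg n (M N : 'M[A]_n) :
  cg M N -> eps_hermitian star eps M -> eps_hermitian star eps N.
Proof.
move=> [X uX ->] hM.
by rewrite /eps_hermitian !adjM adjK hM -scalemxAl -scalemxAr !mulmxA.
Qed.

Lemma hermitian_drblock n1 n2 (H : 'M[A]_n1) (M : 'M_n2) :
  eps_hermitian star eps (block_mx H 0 0 M) -> eps_hermitian star eps M.
Proof.
by rewrite /eps_hermitian adj_block scale_block_mx => /eq_block_mx [].
Qed.

(** An invertible corner has an orthogonal complement: the column operation that clears [B] has an
    adjoint that clears [L], because [M] is hermitian up to [eps]. *)
Lemma hermitian_split n1 n2 (M : 'M[A]_(n1 + n2)) :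
  eps_hermitian star eps M -> ulsubmx M \in unitmx ->
  exists M1, cg M (block_mx (ulsubmx M) 0 0 M1).
Proof.
set H := ulsubmx M; pose B := ursubmx M.
pose L := dlsubmx M; pose D := drsubmx M.
have ME : M = block_mx H B L D by rewrite submxK.
rewrite {1}ME /eps_hermitian adj_block scale_block_mx.
move=> /eq_block_mx [hH hL hB _] uH.
pose Z := adj (invmx H *m B).
have ZH : Z *m H = L.
  have -> : H = eps *: adj H by rewrite hH scalerA sign_sqr scale1r.
  rewrite -scalemxAr -adjM mulmxA mulmxV // mul1mx hB scalerA sign_sqr.
  by rewrite scale1r.
exists (D - Z *m B), (block_mx 1%:M (- (invmx H *m B)) 0 1%:M).
  by rewrite unitmx_ublock !unitmx1.
rewrite {1}ME adj_block !adj1 adj0 linearN /= map_mxN -/Z !mulmx_block.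
rewrite !(mulmx0, mul0mx, mulmx1, mul1mx, addr0, add0r) !mulNmx ZH addNr.
by rewrite mul0mx add0r mulmxN mulmxA mulmxV // mul1mx addNr addrC.
Qed.

End Hermitian.

Variables (y : A) (y_unif : uniformizer y).
Hypothesis A_complete : dvr_complete A.
Hypothesis unit2 : (2%:R : A) \is a GRing.unit.

(** * Hermitian case: splitting off 1 *)

Section Symmetric.

Hypothesis norm_surj : norm_surjective star.

Lemma mul_delta_entry n (M : 'M[A]_n) i j k :
  ((delta_mx i j : 'M_n) *m M) i k = M j k.
Proof.
rewrite mxE (bigD1 j) //= mxE !eqxx mul1r big1 ?addr0 // => l lj.
by rewrite mxE (negPf lj) andbF mul0r.
Qed.

Lemma delta_mul_entry n (M : 'M[A]_n) i j k :
  (M *m (delta_mx i j : 'M_n)) k j = M k i.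
Proof.
rewrite mxE (bigD1 i) //= mxE !eqxx mulr1 big1 ?addr0 // => l li.
by rewrite mxE (negPf li) mulr0.
Qed.

(** If [M i j] is a unit but [M i i] and [M j j] are not, replace the basis vector [e_i] by
    [e_i + l e_j] with [l] the inverse of [M i j]: the cross terms add up to 2 and the rest is a
    nonunit. *)
Lemma hermitian_unit_diag n (M : 'M[A]_n) :
  eps_hermitian star 1 M -> has_unit M ->
  exists N, cg M N /\ exists i, N i i \is a GRing.unit.
Proof.
move=> hM /has_unitP [i [j uij]].
have [uii|nii] := boolP (M i i \is a GRing.unit).
  by exists M; split; [exact: cg_refl|exists i].
have [ujj|njj] := boolP (M j j \is a GRing.unit).
  by exists M; split; [exact: cg_refl|exists j].
have ji : j != i by apply: contraNneq nii => ji; rewrite -{2}ji.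
pose l := (M i j)^-1.
pose X : 'M[A]_n := 1%:M + l *: delta_mx j i.
have XV : X *m (1%:M - l *: delta_mx j i) = 1%:M.
  rewrite mulmxDl mul1mx mulmxBr mulmx1 -scalemxAl -scalemxAr.
  by rewrite mul_delta_mx_0 1?eq_sym // !scaler0 subr0 subrK.
have [uX _] := mulmx1_unit XV.
exists (adj X *m M *m X); split; first by exists X.
exists i.
have -> : adj X = 1%:M + star l *: delta_mx i j.
  rewrite linearD /= map_mxD adj1 adjZ trmx_delta.
  by congr (_ + _ *: _); apply/matrixP => a b; rewrite !mxE rmorph_nat.
have -> : ((1%:M + star l *: delta_mx i j) *m M *m X) i i =
    star l * M j i + l * M i j + (M i i + l * star l * M j j).
  have row_i k : ((1%:M + star l *: delta_mx i j) *m M) i k =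
      M i k + star l * M j k.
    by rewrite mulmxDl mul1mx -scalemxAl 2!mxE mul_delta_entry.
  rewrite mulmxDr mulmx1 -scalemxAr mxE [X in _ + X]mxE delta_mul_entry.
  by rewrite !row_i; ring.
have -> : star l * M j i + l * M i j = 2%:R.
  have <- : star (M i j) = M j i by rewrite (hermitian_entry _ _ hM) mul1r.
  by rewrite /l (starV starK) !mulVr ?(star_unit starK).
by rewrite unitrD_nonunit // nonunitD // nonunitMl.
Qed.

(** A unit diagonal entry is fixed by [star], hence a norm, hence congruent to 1. *)
Lemma hermitian_split1 n (M : 'M[A]_(1 + n)) :
  eps_hermitian star 1 M -> has_unit M ->
  exists M1, cg M (block_mx (1%:M : 'M_1) 0 0 M1).
Proof.
move=> hM uM; have [N [MN [i ui]]] := hermitian_unit_diag hM uM.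
pose L : 'M[A]_(1 + n) := \matrix_(k, l) N (tperm 0 i k) (tperm 0 i l).
have ML : cg M L by apply: cg_trans MN (cg_perm _ _).
have hL := hermitian_cg ML hM.
have L00 : L 0 0 = N i i by rewrite mxE tpermL.
have [|M1 LM1] := hermitian_split (or_introl erefl) hL.
  by rewrite unitmx11 !mxE lshift0 !tpermL.
exists M1; apply: cg_trans ML (cg_trans LM1 _).
apply: cg_block (cg_refl _).
have [||z zE] :=
  norm_fixed_unit y_unif A_complete unit2 starK (a := L 0 0) norm_surj.
- by rewrite L00.
- by rewrite (hermitian_entry _ _ hL) mul1r.
have uz : z \is a GRing.unit.
  by move: ui; rewrite -L00 zE unitrM => /andP [].
apply: cg_sym; exists z%:M.
  by rewrite unitmx11 mxE.
rewrite tr_scalar_mx map_scalar_mx mulmx1 -scalar_mxM /= -zE.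
by rewrite [LHS]mx11_scalar !mxE lshift0.
Qed.

End Symmetric.

(** * Skew case: splitting off the hyperbolic plane *)

Section Skew.

(** Named entries reduce congruences of planes to identities in [A]. *)
Definition mx2 (a b c d : A) : 'M[A]_2 :=
  \matrix_(i, j) if i == 0 then if j == 0 then a else b
                 else if j == 0 then c else d.

Lemma mx2E (M : 'M[A]_2) : M = mx2 (M 0 0) (M 0 1) (M 1 0) (M 1 1).
Proof.
apply/matrixP => -[[|[|//]] ?] -[[|[|//]] ?]; rewrite mxE /=;
  by congr (M _ _); exact: val_inj.
Qed.

Lemma mulmx2 a b c d a' b' c' d' :
  mx2 a b c d *m mx2 a' b' c' d' =
  mx2 (a * a' + b * c') (a * b' + b * d') (c * a' + d * c') (c * b' + d * d').
Proof.
apply/matrixP => i j; rewrite !mxE !big_ord_recl big_ord0 addr0 !mxE /=.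
by case: (i == 0); case: (j == 0).
Qed.

Lemma adj_mx2 a b c d :
  adj (mx2 a b c d) = mx2 (star a) (star c) (star b) (star d).
Proof. by apply/matrixP => i j; rewrite !mxE; do 2!case: ifP. Qed.

Lemma unit_mx2 a b c d :
  (mx2 a b c d \in unitmx) = (a * d - b * c \is a GRing.unit).
Proof.
rewrite unitmxE (expand_det_row _ 0) !big_ord_recl big_ord0 /cofactor !det_mx11.
by rewrite !mxE /= expr0 expr1 mul1r mulN1r addr0 mulrN.
Qed.

(** Scale [u] to 1, move to an isotropic first vector by solving a quadratic equation whose
    discriminant is a square, then normalize the pairing and clear the last diagonal entry. *)
Lemma cg_hyperbolic a u d :
  star a = - a -> star d = - d -> a \isn't a GRing.unit ->
  u \is a GRing.unit -> cg (mx2 a u (- star u) d) (mx2 0 1 (- 1) 0).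
Proof.
move=> aE dE na uu.
pose d1 := star u^-1 * d * u^-1.
have d1E : star d1 = - d1 by rewrite !rmorphM starK dE /d1; ring.
apply: (@cg_trans _ _ (mx2 a 1 (- 1) d1)).
  exists (mx2 1 0 0 u^-1); first by rewrite unit_mx2 mul1r mul0r subr0 unitrV.
  have us : star u * star u^-1 = 1 by rewrite -rmorphM mulrV // rmorph1.
  have uu1 : u * u^-1 = 1 by rewrite mulrV.
  rewrite adj_mx2 !mulmx2 rmorph1 rmorph0; congr mx2; rewrite /d1.
  - ring.
  - by transitivity (u * u^-1); [|ring].
  - by transitivity (- (star u * star u^-1)); [rewrite us|ring].
  - ring.
clearbody d1.
have [||w [w2 nw wE]] :=
  @sqrt_fixed _ _ y_unif A_complete unit2 star starK (a * d1).
- by rewrite nonunitMr.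
- by rewrite rmorphM aE d1E mulrNN.
have uw : 1 + w \is a GRing.unit.
  have -> : 1 + w = 2%:R + (w - 1) by ring.
  exact: unitrD_nonunit.
(* The root [(1 - w) / d1] of [d1 t^2 - 2 t - a], rewritten to avoid dividing by [d1], which may be
   a nonunit. *)
pose l : A := - a / (1 + w).
have lw : l * (1 + w) = - a by rewrite /l divrK.
have lE : star l = - l.
  by rewrite /l rmorphM rmorphN (starV starK) rmorphD rmorph1 wE aE; ring.
(* The left side is the value of the form at the vector with coordinates 1 and [l], since
   [star l = - l]. *)
have iso : a + 2%:R * l - l ^+ 2 * d1 = 0.
  apply: (mulIr (unitrX 2 uw)); rewrite mul0r.
  have -> : (a + 2%:R * l - l ^+ 2 * d1) * (1 + w) ^+ 2 =
     a * (1 + w) ^+ 2 + 2%:R * (l * (1 + w)) * (1 + w)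
       - (l * (1 + w)) ^+ 2 * d1.
    by ring.
  have -> : (1 + w) ^+ 2 = 2%:R * (1 + w) + a * d1.
    by rewrite (_ : a * d1 = w ^+ 2 - 1); [ring|rewrite w2; ring].
  by rewrite lw; ring.
have nl : l \isn't a GRing.unit by rewrite nonunitMr ?unitrN.
apply: (@cg_trans _ _ (mx2 0 (1 - l * d1) (- (1 - l * d1)) d1)).
  exists (mx2 1 0 l 1); first by rewrite unit_mx2 mul0r subr0 mul1r unitr1.
  rewrite adj_mx2 !mulmx2 rmorph1 rmorph0 lE; congr mx2.
  - by rewrite -[LHS]iso; ring.
  - ring.
  - ring.
  - ring.
pose c := 1 - l * d1.
have uc : c \is a GRing.unit.
  by rewrite unitrD_nonunit ?unitr1 // unitrN nonunitMr.
have cE : star c = c by rewrite /c rmorphB rmorph1 rmorphM lE d1E mulrNN.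
have cV : c * c^-1 = 1 by rewrite mulrV.
(* A second column with coordinates [s] and [c^-1] pairs to 1 with the first vector and has value
   [star s - s + c^-1 ^+ 2 * d1], which vanishes for this skew [s]. *)
rewrite -/c; exists (mx2 1 (c^-1 ^+ 2 * d1 / 2%:R) 0 c^-1).
  by rewrite unit_mx2 mulr0 subr0 mul1r unitrV.
rewrite adj_mx2 !mulmx2 rmorph1 rmorph0 !rmorphM.
rewrite !(starV starK) !cE d1E rmorph_nat.
congr mx2.
- ring.
- by transitivity (c * c^-1); [|ring].
- by transitivity (- (c * c^-1)); [rewrite cV|ring].
have h2 : (2%:R : A)^-1 + 2%:R^-1 = 1.
  by rewrite -mulr2n -[_ *+ 2]mulr_natr mulVr.
transitivity (c^-1 ^+ 2 * d1 * (1 - (c * c^-1) * (2%:R^-1 + 2%:R^-1))).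
  by rewrite cV h2; ring.
ring.
Qed.

(** The plane on the indices [i] and [j] is invertible: its determinant is the unit
    [M i j * star (M i j)] plus a nonunit. *)
Lemma skew_split2 n (M : 'M[A]_(2 + n)) :
  eps_hermitian star (-1) M -> has_unit M ->
  (forall i, M i i \isn't a GRing.unit) ->
  exists M1, cg M (block_mx (mx2 0 1 (- 1) 0) 0 0 M1).
Proof.
move=> hM /has_unitP [i [j uij]] nd.
have ij : j != i by apply: contraTneq uij => ->; exact: nd.
pose i1 : 'I_(2 + n) := 1.
(* Products of permutations apply the left factor first, so [s] sends 0 to [i] and 1 to
   [t (t j) = j]. *)
pose t : 'S_(2 + n) := tperm 0 i; pose s : 'S_(2 + n) := (tperm i1 (t j) * t)%g.
have t0 : t 0 = i by rewrite tpermL.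
have tj0 : t j != 0.
  by rewrite -[0](tpermR 0 i) (inj_eq perm_inj).
have s0 : s 0 = i by rewrite permM [tperm i1 _ _]tpermD.
have s1 : s i1 = j by rewrite permM [tperm i1 _ _]tpermL -permM tperm2 perm1.
pose L : 'M[A]_(2 + n) := \matrix_(k, l) M (s k) (s l).
have ML : cg M L by exact: cg_perm.
have hL := hermitian_cg ML hM.
have HE : ulsubmx L = mx2 (M i i) (M i j) (- star (M i j)) (M j j).
  rewrite [LHS]mx2E !mxE.
  have -> : lshift n (0 : 'I_2) = 0 by exact: val_inj.
  have -> : lshift n (1 : 'I_2) = i1 by exact: val_inj.
  by rewrite s0 s1 (hermitian_entry _ _ hM) mulN1r opprK.
have [||M1 LM1] := hermitian_split _ hL; first by right.
  rewrite HE unit_mx2 addrC unitrD_nonunit ?nonunitMr //.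
  by rewrite mulrN opprK unitrM uij (star_unit starK).
exists M1; apply: cg_trans ML (cg_trans LM1 _).
apply: cg_block (cg_refl _); rewrite HE; apply: cg_hyperbolic => //.
- by rewrite (hermitian_entry _ _ hM) mulN1r.
- by rewrite (hermitian_entry _ _ hM) mulN1r.
Qed.

End Skew.

(** * From equivalence to congruence *)

Hypothesis norm_surj : norm_surjective star.

(** The induction is strong because a skew step lowers the size by 2, and it is uniform in [eps]
    because stripping a skew uniformizer or scaling by a skew unit changes the sign. *)
Lemma equivalent_cg n eps (M N : 'M[A]_n) :
  eps = 1 \/ eps = -1 -> eps_hermitian star eps M ->
  eps_hermitian star eps N -> equivalent M N -> cg M N.
Proof.
have [z [z_unif zE]] := uniformizer_sign y_unif unit2 starK.
elim/ltn_ind: n eps M N => -[|n] IH.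
  by move=> eps M N *; exists 1%:M; rewrite ?unitmx1 //; apply/matrixP => -[].
have herm1 (M' N' : 'M[A]_n.+1) : eps_hermitian star 1 M' ->
    eps_hermitian star 1 N' -> has_unit M' -> equivalent M' N' -> cg M' N'.
  move=> hM' hN' uM' M'N'; have uN' := equivalent_has_unit M'N' uM'.
  have [M1 M'M1] := hermitian_split1 norm_surj hM' uM'.
  have [N1 N'N1] := hermitian_split1 norm_surj hN' uN'.
  apply: (cg_trans M'M1 (cg_trans _ (cg_sym N'N1))).
  apply: cg_block; first exact: cg_refl.
  apply: (IH n (ltnSn n) 1); first by left.
  - exact: hermitian_drblock (hermitian_cg M'M1 hM').
  - exact: hermitian_drblock (hermitian_cg N'N1 hN').
  apply: equivalent_cancel.
  apply: equivalent_trans (equivalent_sym (cg_equivalent M'M1)) _.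
  exact: equivalent_trans M'N' (cg_equivalent N'N1).
have skew (M' N' : 'M[A]_n.+1) : eps_hermitian star (-1) M' ->
    eps_hermitian star (-1) N' -> has_unit M' -> equivalent M' N' ->
    (forall i, M' i i \isn't a GRing.unit) ->
    (forall i, N' i i \isn't a GRing.unit) -> cg M' N'.
  case: n IH M' N' {herm1} => [|n] IH M' N' hM' hN' uM' M'N' ndM ndN.
    (* In size 1 the unit entry would lie on the diagonal. *)
    have /has_unitP [i [j]] := uM'.
    by rewrite (ord1 i) (ord1 j) (negPf (ndM 0)).
  have uN' := equivalent_has_unit M'N' uM'.
  have [M1 M'M1] := @skew_split2 n M' hM' uM' ndM.
  have [N1 N'N1] := @skew_split2 n N' hN' uN' ndN.
  have uJ : mx2 0 1 (- 1) 0 \in unitmx.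
    by rewrite unit_mx2 mul0r mul1r opprK add0r unitr1.
  (* Up to equivalence the hyperbolic plane is an identity block, so the cancellation of blocks 1
     applies to it. *)
  have J1 : equivalent (mx2 0 1 (- 1) 0) (1%:M : 'M_2).
    by exists 1%:M, (invmx (mx2 0 1 (- 1) 0));
      rewrite unitmx1 unitmx_inv mul1mx mulmxV.
  apply: (cg_trans M'M1 (cg_trans _ (cg_sym N'N1))).
  apply: cg_block; first exact: cg_refl.
  apply: (IH n _ (-1)) => //; first by right.
  - exact: hermitian_drblock (hermitian_cg M'M1 hM').
  - exact: hermitian_drblock (hermitian_cg N'N1 hN').
  have split1 (L : 'M[A]_n) : equivalent (block_mx (mx2 0 1 (- 1) 0) 0 0 L)
      (block_mx (1%:M : 'M_1) 0 0 (block_mx (1%:M : 'M_1) 0 0 L)).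
    rewrite -block_mx11A; exact: equivalent_block J1 (equivalent_refl L).
  apply/equivalent_cancel/equivalent_cancel.
  apply: equivalent_trans (equivalent_sym (split1 M1)) _.
  apply: equivalent_trans (split1 N1).
  apply: equivalent_trans (equivalent_sym (cg_equivalent M'M1)) _.
  exact: equivalent_trans M'N' (cg_equivalent N'N1).
move=> eps M N eps_sign hM hN MN.
have [M0|M0] := eqVneq M 0.
  have [P [Q [_ _ <-]]] := MN.
  by rewrite M0 mulmx0 mul0mx; exact: cg_refl.
have [k [M' [uM' ME]]] := unif_scale z_unif M0.
have zk0 : z ^+ k != 0 by rewrite expf_neq0 // z_unif.1.
have [P [Q [uP uQ NE]]] := MN.
pose N' := P *m M' *m Q.
have NE' : N = z ^+ k *: N' by rewrite -NE ME -scalemxAr -scalemxAl.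
have M'N' : equivalent M' N' by exists P, Q.
have uN' := equivalent_has_unit M'N' uM'.
have [del [del_sign zkE]] : exists del, (del = 1 \/ del = -1) /\
    star (z ^+ k) = del * z ^+ k.
  case: zE => zE; first by exists 1; rewrite rmorphXn zE mul1r; split; [left|].
  exists ((-1) ^+ k); split; last by rewrite rmorphXn zE [(- z) ^+ k]exprNn.
  by rewrite -signr_odd; case: odd; [right|left].
(* The sign after division by [z ^+ k]: it flips when [z] is skew and [k] is odd. *)
pose e := del * eps.
have e_sign : e = 1 \/ e = -1.
  rewrite /e; case: del_sign => ->; case: eps_sign => ->;
    rewrite ?mulrNN ?mul1r ?mulr1; auto.
have herm_div (L L' : 'M[A]_n.+1) : L = z ^+ k *: L' ->
    eps_hermitian star eps L -> eps_hermitian star e L'.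
  move=> -> /matrixP hL; apply/matrixP => i j.
  have := hL i j; rewrite !mxE rmorphM zkE => hij.
  apply: (mulfI zk0).
  have <- : del * (del * z ^+ k * star (L' j i)) = z ^+ k * star (L' j i).
    by rewrite !mulrA sign_sqr // mul1r.
  by rewrite hij /e; ring.
have hM' := herm_div _ _ ME hM; have hN' := herm_div _ _ NE' hN.
rewrite ME NE'; apply: cg_scale.
case: e_sign => eE; rewrite eE in hM' hN'; first exact: herm1.
(* Multiplying by a skew unit turns skew matrices into hermitian ones, and congruence is unaffected
   by scaling with [s] and back. *)
have scaled s : s \is a GRing.unit -> star s = - s -> cg M' N'.
  move=> us sE.
  have herm_s (L : 'M[A]_n.+1) :
      eps_hermitian star (-1) L -> eps_hermitian star 1 (s *: L).
    move=> hL; rewrite /eps_hermitian adjZ hL sE scalerA.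
    by rewrite mulrNN mulr1 scale1r.
  have := herm1 _ _ (herm_s _ hM') (herm_s _ hN') _ (equivalent_scale s M'N').
  have -> : has_unit (s *: M').
    have /has_unitP [i [j uij]] := uM'.
    by apply/has_unitP; exists i, j; rewrite mxE unitrM us.
  move=> /(_ isT) /(cg_scale s^-1).
  by rewrite !scalerA mulVr // !scale1r.
(* Diagonal entries of a skew matrix are skew, so any unit among them serves as [s]. *)
have [/existsP [i ui]|/existsPn ndM] :=
  boolP [exists i, M' i i \is a GRing.unit].
  by apply: (scaled _ ui); rewrite (hermitian_entry _ _ hM') mulN1r.
have [/existsP [i ui]|/existsPn ndN] :=
  boolP [exists i, N' i i \is a GRing.unit].
  by apply: (scaled _ ui); rewrite (hermitian_entry _ _ hN') mulN1r.
exact: skew.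
Qed.

End Congruence.

Theorem theorem8 (A : dvrType) (star : {rmorphism A -> A})
    (hcomplete : dvr_complete A)
    (h2 : (2%:R : A) \is a GRing.unit)
    (hstar : involutive star)
    (hnorm : norm_surjective star)
    (eps : A) (heps : eps = 1 \/ eps = -1)
    (m : nat) (hm : (0 < m)%N)
    (M N : 'M[A]_m)
    (hM : eps_hermitian star eps M)
    (hN : eps_hermitian star eps N) :
  star_congruent star M N <-> same_invariant_factors M N.
Proof.
have [y y_unif] := uniformizer_exists A.
split=> [MN|/(equivalent_same_invariant_factors y_unif) MN].
  by apply/(equivalent_same_invariant_factors y_unif)/(cg_equivalent hstar MN).
exact: (equivalent_cg hstar y_unif hcomplete h2 hnorm heps).
Qed.
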